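(* If $E$ is a $*$-WTRO then $E$ is ternary $*$-isomorphic, via a complete order isomorphism, to $M\oplus^\infty Z$, where $M$ is a W*-algebra, and $Z$ is a trivially ordered $*$-WTRO.
   Context: A $*$-WTRO is a weak* closed selfadjoint subspace $E$ of a W*-algebra $N$ with $EE^*E\subset E$. It has the ternary product $[x,y,z]=xy^*z$, the inherited involution and operator space structure, and the relative matrix cones $M_n(E)_+=M_n(E)\cap M_n(N)_+$. It is trivially ordered if its positive cone is $\{0\}$. A ternary $*$-isomorphism is a bijective $*$-linear map preserving the ternary product. The direct sum $M\oplus^\infty Z$ is the $\ell^\infty$-direct sum with componentwise operations, involution and cones. *)

(* Defs.v *)
(* MathComp / MathComp-Analysis development over the complex numbers [R[i]],
   for an arbitrary [R : realType]. *)
From HB Require Import structures.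
From mathcomp Require Import all_boot all_order all_algebra sesquilinear.
From mathcomp Require Import complex.
From mathcomp Require Import all_classical all_reals.
From mathcomp Require Import topology normedtype sequences.

Set Implicit Arguments.
Unset Strict Implicit.
Unset Printing Implicit Defensive.

Import Order.TTheory GRing.Theory Num.Theory numFieldNormedType.Exports.

Local Open Scope classical_set_scope.
Local Open Scope ring_scope.
Local Open Scope complex_scope.

(* [inner x y] is linear in [x] and conjugate-linear in [y].  The space [0] is
   allowed. *)
Record hilbertSpace (R : realType) := HilbertSpace {
  hilbert_sort :> completeNormedModType R[i];
  inner : {dot hilbert_sort for (@Num.conj R[i])};
  inner_norm : forall x : hilbert_sort, `|x| ^+ 2 = inner x x
}.

(* M_n(A), for a subset [A] of [V]. *)
Definition mx_set (V : Type) (A : set V) (n : nat) : set 'M[V]_n :=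
  [set x | forall i j, A (x i j)].

Arguments mx_set {V} A {n} _.

Section Operators.
Context {R : realType} {H : hilbertSpace R}.
Implicit Types (x y : H -> H) (A E : set (H -> H)).

(* B(H), as a set of functions; sums and scalar multiples of operators are the
   pointwise ones, and the product of operators is composition. *)
Definition bounded_ops : set (H -> H) :=
  [set x | linear x /\ exists K : R[i], forall v, `|x v| <= K * `|v|].

Definition is_adjoint x y :=
  bounded_ops y /\ forall u v, inner H (x u) v = inner H u (y v).

(* By the Riesz representation theorem [adj x] is the adjoint of [x], for [x]
   in B(H); the default value 0 is only reached outside B(H). *)
Definition adj x : H -> H := xget 0 [set y | is_adjoint x y].

Definition square_summable (xi : nat -> H) :=
  exists B : R[i], forall n, \sum_(k < n) `|xi k| ^+ 2 <= B.

(* For square summable [xi] and [eta] these are exactly the elements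
   x |-> \sum_k <x xi_k, eta_k> of the predual of B(H). *)
Definition normal_functional (xi eta : nat -> H) x : R[i] :=
  limn (series (fun k => inner H (x (xi k)) (eta k) : R[i]^o)).

(* [x] belongs to the closure of [E] for the weak* topology, whose basic
   neighbourhoods are given by finitely many elements of the predual. *)
Definition weak_star_closure E : set (H -> H) := [set x |
  forall (m : nat) (xi eta : 'I_m -> nat -> H) (e : R[i]),
    (forall i, square_summable (xi i)) -> (forall i, square_summable (eta i)) ->
    0 < e ->
    exists2 y, E y & forall i, `|normal_functional (xi i) (eta i) (x - y)| < e].

Definition weak_star_closed_in A E :=
  E `<=` A /\ A `&` weak_star_closure E `<=` E.

Definition is_subspace E :=
  E 0 /\ forall (a : R[i]) x y, E x -> E y -> E (a *: x + y).

(* Positivity in M_n(B(H)) = B(H^n):  <x xi, xi> >= 0 for all xi in H^n. *)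
Definition positive_mx n (x : 'M[H -> H]_n) : Prop :=
  forall xi : 'I_n -> H,
    0 <= \sum_(i < n) \sum_(j < n) inner H (x i j (xi j)) (xi i).

End Operators.

(* W*-algebras are presented as von Neumann algebras, that is as weak* closed
   selfadjoint subalgebras of some B(H).  The identity element is not required
   to be the identity operator of [H]: it is a projection e, and the algebra is
   then a von Neumann algebra in the usual sense on the Hilbert space e(H). *)
Record WstarAlgebra (R : realType) := MkWstarAlgebra {
  wstar_space : hilbertSpace R;
  wstar_set : set (wstar_space -> wstar_space);
  wstar_closed : weak_star_closed_in bounded_ops wstar_set;
  wstar_subspace : is_subspace wstar_set;
  wstar_adj : forall x, wstar_set x -> wstar_set (adj x);
  wstar_mul : forall x y, wstar_set x -> wstar_set y -> wstar_set (x \o y);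
  wstar_unit : exists2 e, wstar_set e &
    forall x, wstar_set x -> e \o x = x /\ x \o e = x
}.

Arguments wstar_set {R} w _ : rename.

(* The weak* topology of the ambient W*-algebra N is the restriction of the one
   of B(H), as N is weak* closed in B(H). *)
Record starWTRO (R : realType) := MkStarWTRO {
  wtro_ambient : WstarAlgebra R;
  wtro_set : set (wstar_space wtro_ambient -> wstar_space wtro_ambient);
  wtro_closed : weak_star_closed_in (wstar_set wtro_ambient) wtro_set;
  wtro_subspace : is_subspace wtro_set;
  wtro_adj : forall x, wtro_set x -> wtro_set (adj x);
  wtro_ternary : forall x y z, wtro_set x -> wtro_set y -> wtro_set z ->
    wtro_set (x \o adj y \o z)
}.

Arguments wtro_set {R} s _ : rename.

(* The structure transported by the isomorphisms below: a subset of a complex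
   vector space, with an involution, a ternary product, and matrix cones, all
   only meaningful on that subset. *)
Record orderedTernary (R : realType) := OrderedTernary {
  ot_sort :> lmodType R[i];
  ot_set : set ot_sort;
  ot_star : ot_sort -> ot_sort;
  ot_prod : ot_sort -> ot_sort -> ot_sort -> ot_sort;
  ot_cone : forall n, set 'M[ot_sort]_n
}.

Arguments ot_set {R} o _ : rename.
Arguments ot_cone {R} o n _ : rename.

Section OrderedTernary.
Context {R : realType}.

Definition wstar_mx_cone (N : WstarAlgebra R) n :
    set 'M[wstar_space N -> wstar_space N]_n :=
  mx_set (wstar_set N) `&` [set x | positive_mx x].

Arguments wstar_mx_cone N n _ : clear implicits.

Definition wtro_mx_cone (E : starWTRO R) n :
    set 'M[wstar_space (wtro_ambient E) -> wstar_space (wtro_ambient E)]_n :=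
  mx_set (wtro_set E) `&` wstar_mx_cone (wtro_ambient E) n.

Arguments wtro_mx_cone E n _ : clear implicits.

Definition wstar_ternary (M : WstarAlgebra R) : orderedTernary R :=
  @OrderedTernary R (wstar_space M -> wstar_space M) (wstar_set M)
    adj (fun x y z => x \o adj y \o z) (wstar_mx_cone M).

Definition wtro_ternary_of (E : starWTRO R) : orderedTernary R :=
  @OrderedTernary R
    (wstar_space (wtro_ambient E) -> wstar_space (wtro_ambient E)) (wtro_set E)
    adj (fun x y z => x \o adj y \o z) (wtro_mx_cone E).

(* The l^oo-direct sum of two summands consists of all pairs; its norm
   max(|x|, |y|) plays no role in the notions of isomorphism below. *)
Definition dsum (S T : orderedTernary R) : orderedTernary R :=
  @OrderedTernary R (ot_sort S * ot_sort T)%type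
    (ot_set S `*` ot_set T)
    (fun x => (ot_star x.1, ot_star x.2))
    (fun x y z => (ot_prod x.1 y.1 z.1, ot_prod x.2 y.2 z.2))
    (fun n => [set x : 'M_n | ot_cone S n (map_mx fst x) /\
                              ot_cone T n (map_mx snd x)]).

Definition trivially_ordered (S : orderedTernary R) :=
  [set x : S | ot_cone S 1%N (const_mx x)] = [set 0].

Record ternary_star_iso (S T : orderedTernary R) (f : S -> T) : Prop := {
  iso_bij : set_bij (ot_set S) (ot_set T) f;
  iso_linear : forall (a : R[i]) x y, ot_set S x -> ot_set S y ->
    f (a *: x + y) = a *: f x + f y;
  iso_star : forall x, ot_set S x -> f (ot_star x) = ot_star (f x);
  iso_prod : forall x y z, ot_set S x -> ot_set S y -> ot_set S z ->
    f (ot_prod x y z) = ot_prod (f x) (f y) (f z)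
}.

Definition complete_order_iso (S T : orderedTernary R) (f : S -> T) :=
  set_bij (ot_set S) (ot_set T) f /\
  forall n (x : 'M[S]_n), mx_set (ot_set S) x ->
    (ot_cone S n x <-> ot_cone T n (map_mx f x)).

End OrderedTernary.

(* Main.v *)
(* Call x an effect if 0 <= x <= 1.  A chain of effects of E converges strongly,
   and its limit lies in E because E is weak* closed; so by Zorn's lemma every
   effect of E lies below a maximal one.  If r is an effect of E, so is
   (3 r - r^3) / 2 >= r, as E is closed under the ternary product; hence a
   maximal effect r satisfies r = (3 r - r^3) / 2 and is a projection.  Comparing
   a maximal effect e with a maximal effect above (e + x) / 2 shows that e
   dominates every effect x of E.

   For x in E the element x^* e x of E is positive, hence supported on e; this
   gives e x = e x e, and likewise for x^*, so that e commutes with E.  Then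
   M = e E is a W*-algebra with unit e, and Z = (1 - e) E is trivially ordered
   since its positive elements are supported on e. *)
Require Import Defs.
From mathcomp Require Import all_boot all_order all_algebra sesquilinear complex ring.
From mathcomp Require Import all_classical all_reals topology normedtype sequences.

Set Implicit Arguments.
Unset Strict Implicit.
Unset Printing Implicit Defensive.

Import Order.TTheory GRing.Theory Num.Theory numFieldNormedType.Exports.

Local Open Scope classical_set_scope.
Local Open Scope ring_scope.
Local Open Scope complex_scope.

(** * Suprema, Cauchy filter bases and series over [R[i]] *)

Section Completeness.
Context {R : realType}.
Local Notation C := R[i].

(** The order of [R[i]] is partial: the real bound [B] forces the elements of [S] to be real, and
    the supremum is taken over their real parts. *)
Lemma almost_max (S : set C) (B e : C) : S !=set0 -> B \is Num.real ->
  (forall x, S x -> x <= B) -> 0 < e ->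
  exists2 x, S x & forall y, S y -> y <= x + e.
Proof.
move=> [x0 Sx0] Breal SB e0.
have toR (x : C) : x \is Num.real -> x = (complex.Re x)%:C.
  by case: x => a b; rewrite realE !lecE /= => /orP[] /andP[/eqP]; [move=> ->|move=> <-].
have Sreal x : S x -> x \is Num.real.
  by by move=> /SB /ler_real ->.
pose ReS := @complex.Re R @` S.
have [s Ss lts] : exists2 s, ReS s & sup ReS - complex.Re e < s.
  apply: sup_adherent; first by move: e0; rewrite ltcE => /andP[].
  split; first by exists (complex.Re x0), x0.
  by exists (complex.Re B) => _ [y /SB yB <-]; move: yB; rewrite lecE => /andP[].
case: Ss lts => x Sx <- lts; exists x => // y Sy.
rewrite (toR _ (Sreal _ Sx)) (toR _ (Sreal _ Sy)) (toR _ (gtr0_real e0)).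
rewrite -rmorphD /= lecR -lerBlDr ltW // (le_lt_trans _ lts) // lerD2r.
apply: ub_le_sup; last by exists y.
by exists (complex.Re B) => _ [z /SB zB <-]; move: zB; rewrite lecE => /andP[].
Qed.

(** Completeness in filter-base form: the sets [A i] generate a proper Cauchy filter. It yields both
    the Riesz vector and the strong limit of a chain of effects. *)
Lemma cauchy_base_cvg (V : completeNormedModType C) (I : Type) (D : set I)
    (A : I -> set V) : D !=set0 -> (forall i, D i -> A i !=set0) ->
  (forall i j, D i -> D j -> exists2 k, D k & A k `<=` A i `&` A j) ->
  (forall e : C, 0 < e -> exists2 i, D i &
     forall u v, A i u -> A i v -> `|u - v| < e) ->
  exists l, forall e : C, 0 < e -> exists2 i, D i &
     forall u, A i u -> `|u - l| < e.
Proof.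
move=> D0 A0 AI small.
have FF : Filter (filter_from D A) by exact: filter_from_filter.
have PF : ProperFilter (filter_from D A) by exact: filter_from_proper.
have /cauchy_cvg cF : cauchy (filter_from D A).
  apply/cauchy_ballP => e e0; have [i Di sm] := small e e0.
  exists (A i, A i) => /=; first by split; exists i.
  by move=> [u v] /= [Au Av]; rewrite -ball_normE /= sm.
exists (lim (filter_from D A)) => e e0.
have [i Di Ai] := cF _ (nbhsx_ballx (lim (filter_from D A)) _ e0).
by exists i => // u /Ai; rewrite -ball_normE /= distrC.
Qed.

Lemma norm_small_eq0 (V : normedModType C) (K : C) (c : V) : 0 < K ->
  (forall e : C, 0 < e -> `|c| <= e * K) -> c = 0.
Proof.
move=> K0 small; apply/eqP/contraT => c0.
have c2 : 0 < `|c| / (2 * K) by rewrite divr_gt0 ?normr_gt0 ?mulr_gt0.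
have := small _ c2; rewrite invfM mulrA divfK ?gt_eqF //.
by rewrite ler_pdivlMr // ger_pMr ?normr_gt0 // (ler_nat _ 2 1).
Qed.

Lemma addr_conj_le_norm (c : C) : c + Num.conj c <= 2 * `|c|.
Proof.
have cr : c + Num.conj c \is Num.real by rewrite CrealE rmorphD /= conjCK addrC.
apply: le_trans (real_ler_norm cr) _; apply: le_trans (ler_normD _ _) _.
by rewrite norm_conjC mulr2n mulrDl mul1r.
Qed.

(** Here [c] is not known to be real. That [c - b] is nonnegative is expressed as [c - b = |c - b|],
    an equation that survives approximation. *)
Lemma ge_approx (b c K : C) : 0 < K ->
  (forall e, 0 < e -> exists2 p, b <= p & `|c - p| <= e * K) -> b <= c.
Proof.
move=> K0 app; rewrite -subr_ge0 -eqr_norm_id eq_sym -subr_eq0; apply/eqP.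
apply: (@norm_small_eq0 C^o (2 * K)); first by rewrite mulr_gt0.
move=> e e0; have [p bp cp] := app e e0.
rewrite mulrCA mulr2n mulrDl mul1r.
have -> : c - b - `|c - b| = (c - p) + (`|p - b| - `|c - b|).
  by rewrite (ger0_norm (x := p - b)) ?subr_ge0 //; ring.
apply: le_trans (ler_normD _ _) _; apply: lerD => //.
apply: le_trans (ler_dist_dist _ _) _.
by rewrite opprB addrA subrK distrC.
Qed.

(** If [u] diverges, [limn u] is the default value 0, which also satisfies the bound. *)
Lemma norm_limn_le (u : nat -> C^o) (B : C) : 0 <= B ->
  (forall n, `|u n| <= B) -> `|limn u| <= B.
Proof.
move=> B0 uB; have [cu|/dvgP ->] := pselect (cvgn u); last by rewrite normr0.
rewrite real_leNgt ?ger0_real //; apply/negP => Bl.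
have /cvgrPdist_lt/(_ (`|limn u| - B)) := cu; rewrite subr_gt0 => /(_ Bl).
move=> [n _ /(_ n (leqnn n))] /=; rewrite ltrBrDr => lt1.
have := le_lt_trans (lerD (lexx `|limn u - u n|) (uB n)) lt1.
by move/(le_lt_trans (ler_normD _ _)); rewrite subrK ltxx.
Qed.

(** The index [N] is that of a partial sum within [e] of the supremum of all partial sums. *)
Lemma small_tail (a : nat -> C) (B e : C) : (forall k, 0 <= a k) ->
  (forall n, \sum_(k < n) a k <= B) -> 0 < e ->
  exists N, forall n, (N <= n)%N -> \sum_(N <= k < n) a k <= e.
Proof.
move=> a0 aB e0; have Br : B \is Num.real.
  by apply: ger0_real; have := aB 0%N; rewrite big_ord0.
pose S := range (fun n => \sum_(k < n) a k).
have [_ [N _ <-] Nmax] := @almost_max S B e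
  (ex_intro _ _ (imageT _ 0%N)) Br (fun _ => ltac:(by move=> [n _ <-])) e0.
exists N => n Nn; have /= := Nmax _ (imageT _ n).
by rewrite -!(big_mkord xpredT) (big_cat_nat (n := N)) //= lerD2l.
Qed.

End Completeness.

(** * Inner products, Cauchy-Schwarz and Riesz representation *)

Section HilbertSpace.
Context {R : realType} {H : hilbertSpace R}.
Local Notation C := R[i].
Local Notation "''[' u , v ]" := (inner H u v).
Implicit Types (u v w : H) (x y z : H -> H).

Lemma innerDl u v w : '[u + v, w] = '[u, w] + '[v, w].
Proof. exact: linearDl. Qed.
Lemma innerDr u v w : '[w, u + v] = '[w, u] + '[w, v].
Proof. exact: linearDr. Qed.
Lemma innerZl (a : C) u v : '[a *: u, v] = a * '[u, v].
Proof. exact: linearZl_LR. Qed.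
Lemma innerZr (a : C) u v : '[u, a *: v] = Num.conj a * '[u, v].
Proof. exact: linearZr_LR. Qed.
Lemma innerNl u v : '[- u, v] = - '[u, v].
Proof. exact: linearNl. Qed.
Lemma innerNr u v : '[u, - v] = - '[u, v].
Proof. exact: linearNr. Qed.
Lemma inner0l u : '[0, u] = 0.
Proof. exact: linear0l. Qed.
Lemma inner0r u : '[u, 0] = 0.
Proof. exact: linear0r. Qed.
Lemma innerC u v : '[u, v] = Num.conj '[v, u].
Proof. by rewrite {1}(hermC (inner H)) expr0 mul1r. Qed.

Definition innerE := (innerDl, innerDr, innerNl, innerNr, innerZl, innerZr).

Lemma inner_ge0 u : 0 <= '[u, u].
Proof. by rewrite -inner_norm exprn_ge0. Qed.

Lemma inner_eq0 u : '[u, u] = 0 -> u = 0.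
Proof. by rewrite -inner_norm => /eqP; rewrite expf_eq0 /= normr_eq0 => /eqP. Qed.

Lemma inner_ext u v : (forall w, '[u, w] = '[v, w]) -> u = v.
Proof.
move=> uv; apply/eqP; rewrite -subr_eq0; apply/eqP/inner_eq0.
by rewrite innerDl innerNl uv subrr.
Qed.

Lemma inner_CauchySchwarz u v : `|'[u, v]| <= `|u| * `|v|.
Proof.
have [->|v0] := eqVneq v 0; first by rewrite inner0r normr0 mulr_ge0.
rewrite -(ler_pXn2r (n := 2)) ?nnegrE ?mulr_ge0 // exprMn !inner_norm.
have vv0 : 0 < '[v, v] by rewrite -inner_norm exprn_gt0 // normr_gt0.
rewrite -subr_ge0 -(pmulr_rge0 _ vv0).
have := inner_ge0 ('[v, v] *: u - '[u, v] *: v).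
rewrite !innerE (innerC v u) -(innerC v v) normCK; congr (0 <= _); ring.
Qed.

(* The representing vector is the limit of any family of near-maximisers of
   v |-> 2 Re phi(v) - |v|^2, by the parallelogram law. *)
Lemma riesz_representation (phi : H -> C) (K : C) :
  (forall a u v, phi (a *: u + v) = a * phi u + phi v) ->
  (forall v, `|phi v| <= K * `|v|) ->
  exists l, forall w, phi w = '[w, l].
Proof.
move=> philin phiK.
have phiD u v : phi (u + v) = phi u + phi v.
  by rewrite -{1}[u]scale1r philin mul1r.
have phi0 : phi 0 = 0.
  by apply/eqP; rewrite -normr_le0; have := phiK 0; rewrite normr0 mulr0.
have phiZ a u : phi (a *: u) = a * phi u.
  by rewrite -[a *: u]addr0 philin phi0 addr0.
pose t v : C := phi v + Num.conj (phi v) - '[v, v].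
have tE u d : t (u + d) = t u + (phi d - '[d, u]) + Num.conj (phi d - '[d, u])
    - '[d, d].
  by rewrite /t phiD !innerE !rmorphD rmorphN /= -(innerC u d); ring.
(* Completing the square: [2 |K| |v| - |v|^2 <= |K|^2]. *)
have tB (x : C) : range t x -> x <= `|K| ^+ 2.
  move=> [v _ <-]; rewrite /t -inner_norm -subr_ge0.
  have le1 : phi v + Num.conj (phi v) <= 2 * (`|K| * `|v|).
    apply: le_trans (addr_conj_le_norm _) _.
    rewrite ler_pM2l //; apply: le_trans (phiK v) _.
    apply: le_trans (real_ler_norm _) _; last by rewrite normrM normr_id.
    by apply: ger0_real; apply: le_trans (phiK v).
  rewrite -subr_ge0 in le1.
  have le2 : 0 <= (`|K| - `|v|) ^+ 2 by rewrite real_exprn_even_ge0 // realB ?normr_real.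
  by have := addr_ge0 le1 le2; congr (0 <= _); ring.
pose A (e : C) := [set v | forall w, t w <= t v + e].
have A0 e : 0 < e -> A e !=set0.
  move=> e0; have [_ [v _ <-] tv] := @almost_max R (range t) _ e
    (ex_intro _ _ (imageT t 0)) (realX 2 (normr_real K)) tB e0.
  by exists v => w; apply: tv; exists w.
have Asub (e f : C) : e <= f -> A e `<=` A f.
  by move=> ef v Av w; apply: le_trans (Av w) _; rewrite lerD2l.
have minC (e f : C) : 0 < e -> 0 < f -> exists2 g, 0 < g & g <= e /\ g <= f.
  move=> e0 f0; have := real_leVge (gtr0_real e0) (gtr0_real f0).
  by case/orP => ef; [exists e|exists f].
(* At the midpoint, [t] exceeds the mean of [t u] and [t v] by [|u - v|^2 / 4], yet it exceeds
   neither value by more than [e]. *)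
have Adiam (e : C) u v : A e u -> A e v -> `|u - v| ^+ 2 <= 4 * e.
  move=> Au Av; have par : 2 * t (2^-1 *: (u + v)) = t u + t v + `|u - v| ^+ 2 / 2.
    rewrite /t inner_norm phiZ phiD !innerE !rmorphM !rmorphD /= fmorphV rmorph_nat.
    by field.
  have : 2 * t (2^-1 *: (u + v)) <= t u + e + (t v + e).
    by rewrite mulr2n mulrDl mul1r lerD.
  rewrite par -subr_ge0 => le2; rewrite -subr_ge0.
  rewrite -(pmulr_rge0 _ (x := 2^-1)) ?invr_gt0 //.
  by move: le2; congr (0 <= _); field.
(* Near-maximality is tested at [u + (conj c / N) w], where the gain [|c|^2 / N + |c|^2 / N^2] can
   be at most [e]. *)
have Aphi (e : C) u w : A e u -> `|phi w - '[w, u]| ^+ 2 <= e * (1 + `|w|) ^+ 2.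
  move=> Au; pose c := phi w - '[w, u]; pose N := 1 + `|w| ^+ 2.
  have N0 : 0 < N by rewrite ltr_wpDr ?exprn_ge0.
  have Nr : Num.conj N = N by apply/CrealP/gtr0_real.
  have := Au (u + (N^-1 * Num.conj c) *: w).
  rewrite tE phiZ innerE -mulrBr -/c innerE innerZr -inner_norm.
  rewrite !rmorphM /= conjCK fmorphV /= Nr -!(addrA (t u)) lerD2l.
  have -> : N^-1 * Num.conj c * c + N^-1 * c * Num.conj c -
      N^-1 * Num.conj c * (N^-1 * c * `|w| ^+ 2) =
      `|c| ^+ 2 / N + `|c| ^+ 2 / N ^+ 2.
    by rewrite normCK /N; field; rewrite -/N gt_eqF.
  move=> le1; have : `|c| ^+ 2 / N <= e.
    by apply: le_trans _ le1; rewrite lerDl divr_ge0 // ?exprn_ge0 // ltW.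
  have e0 : 0 <= e by rewrite -(lerD2l (t u)) addr0; apply: Au.
  rewrite ler_pdivrMr // => /le_trans; apply; apply: ler_wpM2l => //.
  by rewrite sqrrD expr1n mul1r lerD2r lerDl mulrn_wge0.
have [l lP] : exists l, forall e : C, 0 < e -> exists2 d, 0 < d &
    forall u, A d u -> `|u - l| < e.
  apply: (@cauchy_base_cvg R H C [set e | 0 < e] A) => //; first by exists 1 => /=.
    move=> i j i0 j0; have [k k0 [ki kj]] := minC i j i0 j0.
    by exists k => // u Au; split; apply: Asub Au.
  move=> e e0; exists (e ^+ 2 / 8); first by rewrite /= divr_gt0 ?exprn_gt0.
  move=> u v /Adiam /[apply] uv.
  rewrite -(ltr_pXn2r (n := 2)) ?nnegrE ?(ltW e0) //.
  apply: le_lt_trans uv _.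
  have -> : 4 * (e ^+ 2 / 8) = e ^+ 2 / 2 :> C by field.
  by rewrite ltr_pdivrMr // ltr_pMr ?exprn_gt0 // ltr1n.
exists l => w; apply/eqP; rewrite -subr_eq0; apply/eqP.
have M0 : 0 < 1 + `|w| by rewrite ltr_wpDr.
apply: (@norm_small_eq0 R C^o (2 * (1 + `|w|))); first by rewrite mulr_gt0.
move=> e e0; have [d d0 dP] := lP e e0.
(* Accuracy [g <= d] puts [u] within [e] of [l]; [g <= e^2] makes the error in [Aphi] at most
   [e (1 + |w|)]. *)
have [g g0 [gd ge]] := minC d (e ^+ 2) d0 (exprn_gt0 2 e0).
have [u Au] := A0 _ g0.
have ul := dP u (Asub _ _ gd _ Au).
have -> : phi w - '[w, l] = (phi w - '[w, u]) + '[w, u - l].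
  by rewrite !innerE; ring.
rewrite mulrCA mulr2n mulrDl mul1r.
apply: le_trans (ler_normD _ _) _; apply: lerD.
  rewrite -(ler_pXn2r (n := 2)) ?nnegrE ?mulr_ge0 ?(ltW M0) ?(ltW e0) //.
  apply: le_trans (Aphi _ _ _ Au) _.
  by rewrite exprMn ler_pM2r // exprn_gt0.
apply: le_trans (inner_CauchySchwarz _ _) _.
rewrite mulrC; apply: ler_pM => //; first exact: ltW.
by rewrite lerDr.
Qed.

(** * Linear operators, bounded operators and adjoints *)

Lemma linear_fun0 x : linear x -> x 0 = 0.
Proof. by move=> xl; have := xl (- 1) 0 0; rewrite scaler0 addr0 scaleN1r addNr. Qed.

Lemma linear_funD x u v : linear x -> x (u + v) = x u + x v.
Proof. by move=> xl; have := xl 1 u v; rewrite !scale1r. Qed.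

Lemma linear_funZ x a u : linear x -> x (a *: u) = a *: x u.
Proof. by move=> xl; have := xl a u 0; rewrite addr0 linear_fun0 //= addr0. Qed.

Lemma linear_funN x u : linear x -> x (- u) = - x u.
Proof. by move=> xl; rewrite -scaleN1r linear_funZ // scaleN1r. Qed.

Lemma linear_funB x u v : linear x -> x (u - v) = x u - x v.
Proof. by move=> xl; rewrite linear_funD // linear_funN. Qed.

(** The constant in [bounded_ops] is a complex number, unconstrained when the space is 0; a nonzero
    vector forces it to be nonnegative, and [1 + |K|] serves in both cases. *)
Lemma bounded_ops_nneg x : bounded_ops x ->
  exists2 K : C, 0 < K & forall v, `|x v| <= K * `|v|.
Proof.
move=> [_ [K xK]]; exists (1 + `|K|); first by rewrite ltr_wpDr.
move=> v; have [->|v0] := eqVneq v 0.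
  by have := xK 0; rewrite normr0 !mulr0.
have := xK v; rewrite -ler_pdivrMr ?normr_gt0 // => xK'.
have K0 : 0 <= K by apply: le_trans xK'; rewrite divr_ge0.
rewrite -ler_pdivrMr ?normr_gt0 //; apply: (le_trans xK').
by rewrite ger0_norm // lerDr.
Qed.

Lemma is_adjoint_uniq x y z : is_adjoint x y -> is_adjoint x z -> y = z.
Proof.
move=> [_ xy] [_ xz]; apply/funext => v.
by apply: inner_ext => w; rewrite innerC -xy xz -innerC.
Qed.

Lemma adj_eq x y : is_adjoint x y -> adj x = y.
Proof.
move=> xy; apply: (@is_adjoint_uniq x) => //.
exact: (@xgetPex _ 0 [set y | is_adjoint x y] (ex_intro _ y xy)).
Qed.

(** Riesz represents [w |-> <x w, v>] by a vector [y v]; uniqueness of that vector makes [y] linear,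
    and [|y v|^2 = <x (y v), v>] bounds it. *)
Lemma is_adjoint_adj x : bounded_ops x -> is_adjoint x (adj x).
Proof.
move=> xb; have [K K0 xK] := bounded_ops_nneg xb; have [xl _] := xb.
have /choice [y yP] : forall v, exists l, forall w, '[x w, v] = '[w, l].
  move=> v; apply: (@riesz_representation _ (K * `|v|)) => [a u w|u].
    by rewrite xl !innerE.
  apply: le_trans (inner_CauchySchwarz _ _) _.
  by rewrite mulrAC ler_wpM2r.
suff xy : is_adjoint x y by rewrite (adj_eq xy).
split; last by move=> u v; rewrite yP.
split.
  move=> a u v; apply: inner_ext => w; rewrite innerC [RHS]innerC.
  by rewrite !innerE -!yP !innerE.
exists K => v; have [->|yv0] := eqVneq (y v) 0; first by rewrite normr0 mulr_ge0 // ltW.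
rewrite -(ler_pM2r (x := `|(y v : H)|)) ?normr_gt0 //.
rewrite -expr2 inner_norm -yP; apply: le_trans (real_ler_norm _) _.
  by rewrite yP ger0_real // inner_ge0.
apply: le_trans (inner_CauchySchwarz _ _) _.
by rewrite mulrAC ler_wpM2r.
Qed.

Lemma bounded_adj x : bounded_ops x -> bounded_ops (adj x).
Proof. by move=> /is_adjoint_adj[]. Qed.

Lemma inner_adjr x u v : bounded_ops x -> '[u, adj x v] = '[x u, v].
Proof. by move=> /is_adjoint_adj[_ ->]. Qed.

Lemma inner_adjl x u v : bounded_ops x -> '[adj x u, v] = '[u, x v].
Proof. by move=> xb; rewrite innerC inner_adjr // -innerC. Qed.

Lemma bounded_comp x y : bounded_ops x -> bounded_ops y -> bounded_ops (x \o y).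
Proof.
move=> xb yb; have [K K0 xK] := bounded_ops_nneg xb.
have [L L0 yL] := bounded_ops_nneg yb; case: xb yb => xl _ [yl _]; split.
  by move=> a u v /=; rewrite yl xl.
exists (K * L) => v /=; apply: le_trans (xK _) _.
by rewrite -mulrA ler_wpM2l // ltW.
Qed.

Lemma bounded_scaleD (a : C) x y :
  bounded_ops x -> bounded_ops y -> bounded_ops (a *: x + y).
Proof.
move=> xb yb; have [K K0 xK] := bounded_ops_nneg xb.
have [L L0 yL] := bounded_ops_nneg yb; split.
  move=> b u v.
  change (a *: x (b *: u + v) + y (b *: u + v) =
    b *: (a *: x u + y u) + (a *: x v + y v)).
  rewrite (xb.1 b) (yb.1 b) !scalerDr !scalerA (mulrC a).
  by rewrite addrACA.
exists (`|a| * K + L) => v; apply: le_trans (ler_normD _ _) _.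
by rewrite mulrDl lerD // normrZ -mulrA ler_wpM2l.
Qed.

Lemma adj_comp x y : bounded_ops x -> bounded_ops y ->
  adj (x \o y) = adj y \o adj x.
Proof.
move=> xb yb; apply: adj_eq; split.
  by apply: bounded_comp; apply: bounded_adj.
by move=> u v /=; rewrite !inner_adjr.
Qed.

Lemma adjB x y : bounded_ops x -> bounded_ops y -> adj (x - y) = adj x - adj y.
Proof.
move=> xb yb; apply: adj_eq; split.
  rewrite addrC -scaleN1r; apply: bounded_scaleD; exact: bounded_adj.
by move=> u v; rewrite !innerE !inner_adjr.
Qed.

(** * Vector functionals and weak* closures *)

Lemma normal_functional_vector x u v : x 0 = 0 ->
  normal_functional (fun k => if k is 0%N then u else 0)
    (fun k => if k is 0%N then v else 0) x = '[x u, v].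
Proof.
move=> x0; rewrite /normal_functional; apply: (@cvg_lim C^o); first exact: norm_hausdorff.
apply: cvg_near_cst; exists 1%N => // n /= n0.
rewrite /series /= -(prednK n0) big_nat_recl //= big1 ?addr0 // => k _.
by rewrite x0 inner0l.
Qed.

Lemma square_summable_vector u :
  square_summable (fun k => if k is 0%N then u else 0 : H).
Proof.
exists (`|u| ^+ 2) => -[|n]; first by rewrite big_ord0 exprn_ge0.
by rewrite big_ord_recl /= big1 ?addr0 // => k _; rewrite normr0 expr0n.
Qed.

(** Vector functionals are weak* continuous, so their kernels are weak* closed. The equations that
    cut [M] and [Z] out of [E] are of this kind. *)
Lemma weak_star_closure_inner0 (E : set (H -> H)) x u v : linear x ->
  weak_star_closure E x ->
  (forall y, E y -> linear y /\ '[y u, v] = 0) -> '[x u, v] = 0.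
Proof.
move=> xl xE E0; apply: (@norm_small_eq0 R C^o 1) => // e e0.
have [y Ey /(_ ord0)] := xE 1%N (fun=> fun k => if k is 0%N then u else 0)
  (fun=> fun k => if k is 0%N then v else 0) e
  (fun=> square_summable_vector u) (fun=> square_summable_vector v) e0.
have [yl yuv] := E0 y Ey.
rewrite normal_functional_vector; last first.
  by change (x 0 - y 0 = 0); rewrite (linear_fun0 xl) (linear_fun0 yl) subr0.
by rewrite mulr1 innerDl innerNl yuv subr0 => /ltW.
Qed.

Lemma weak_star_closureS (E F : set (H -> H)) :
  E `<=` F -> weak_star_closure E `<=` weak_star_closure F.
Proof.
move=> EF x xE m xi eta e s1 s2 e0.
by have [y /EF Fy yP] := xE m xi eta e s1 s2 e0; exists y.
Qed.

(** On the unit ball strong convergence implies weak* convergence: square summability makes the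
    tails of the series uniformly small, and finitely many terms remain. *)
Lemma strong_limit_weak_star_closure (E : set (H -> H)) x
    (G : set_system (H -> H)) : ProperFilter G ->
  G (fun y => E y /\ forall v, `|y v| <= `|v|) ->
  (forall v, `|x v| <= `|v|) ->
  (forall v e, 0 < e -> G (fun y => `|y v - x v| < e)) ->
  weak_star_closure E x.
Proof.
move=> FG GE x1 Gx m xi eta e xis etas e0.
have e4 : 0 < e / 4 by rewrite divr_gt0.
suff near_i (i : 'I_m) : G (fun y => (forall v, `|y v| <= `|v|) ->
    `|normal_functional (xi i) (eta i) (x - y)| < e).
  have [y [[Ey y1] yP]] := filter_ex (filterI GE (filter_forall _ near_i)).
  by exists y => // i; apply: yP.
have [B1 xiB] := xis i; have [B2 etaB] := etas i.
have [||N Ntail] := @small_tail R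
  (fun k => `|xi i k| ^+ 2 + `|eta i k| ^+ 2) (B1 + B2) _ _ _ e4.
- by move=> k; rewrite addr_ge0 ?exprn_ge0.
- by move=> n; rewrite big_split lerD.
(* With this tolerance the first [N] terms add up to at most [e / 4]; the summand 1 in [1 + |eta_k|]
   avoids a division by 0. *)
have near_k (k : 'I_N) : G (fun y => `|y (xi i k) - x (xi i k)| <
    e / 4 / N%:R / (1 + `|eta i k|)).
  apply: Gx; rewrite !divr_gt0 //; first by rewrite ltr0n (leq_ltn_trans _ (ltn_ord k)).
  by rewrite ltr_wpDr.
apply: filterS _ (filter_forall _ near_k) => y yk y1.
have e2 : e / 2 < e by rewrite ltr_pdivrMr // ltr_pMr // ltr1n.
apply: le_lt_trans e2; apply: norm_limn_le => [|n].
  by rewrite divr_ge0 // ltW.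
(* A bound independent of [y], from [|(x - y) xi_k| <= 2 |xi_k|] and [2 a b <= a^2 + b^2]. *)
have term k : `|'[(x - y) (xi i k), eta i k]| <= `|xi i k| ^+ 2 + `|eta i k| ^+ 2.
  apply: le_trans (inner_CauchySchwarz _ _) _.
  have le2 : `|(x - y) (xi i k)| <= 2 * `|xi i k|.
    by apply: le_trans (ler_normB _ _) _; rewrite mulr2n mulrDl mul1r lerD.
  apply: le_trans (ler_wpM2r (normr_ge0 _) le2) _; rewrite -subr_ge0.
  have : 0 <= (`|xi i k| - `|eta i k|) ^+ 2.
    by rewrite real_exprn_even_ge0 // realB ?normr_real.
  by congr (0 <= _); ring.
rewrite /series /=; apply: le_trans (ler_norm_sum _ _ _) _.
have -> : e / 2 = e / 4 + e / 4 by field.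
have head p : (p <= N)%N ->
    \sum_(0 <= k < p) `|'[(x - y) (xi i k), eta i k]| <= e / 4.
  move=> pN; apply: le_trans (_ : \sum_(0 <= k < p) (e / 4 / N%:R) <= _).
    rewrite big_nat [leRHS]big_nat; apply: ler_sum => k /andP[_ kp].
    have kN := leq_trans kp pN.
    apply: le_trans (inner_CauchySchwarz _ _) _.
    have /ltW := yk (Ordinal kN); rewrite /= distrC ler_pdivlMr ?ltr_wpDr //.
    by apply: le_trans; rewrite ler_wpM2l // lerDr.
  rewrite sumr_const_nat subn0 -(mulr_natr (e / 4 / N%:R)).
  have [->|p0] := posnP p; first by rewrite mulr0n mulr0 ltW.
  rewrite -mulrA ger_pMr // mulrC ler_pdivrMr ?mul1r ?ler_nat //.
  by rewrite ltr0n (leq_trans p0).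
have [nN|Nn] := leqP n N.
  by apply: le_trans (head n nN) _; rewrite lerDl ltW.
rewrite (big_cat_nat (n := N)) //= ?(ltnW Nn) //; apply: lerD; first exact: head.
by apply: le_trans (Ntail n (ltnW Nn)); apply: ler_sum => k _.
Qed.

(** * Effects and their order *)

Definition lef x y := forall v, '[x v, v] <= '[y v, v].

Definition effect x := [/\ linear x, forall u v, '[x u, v] = '[u, x v],
  forall v, 0 <= '[x v, v] & forall v, '[x v, v] <= '[v, v]].

(** This is [x^2 <= x], from [x - x^2 = (1 - x) x (1 - x) + x (1 - x) x]. *)
Lemma effect_sqr_le x u : effect x -> '[x u, x u] <= '[x u, u].
Proof.
move=> [xl xs x0 x1]; rewrite -subr_ge0.
have -> : '[x u, u] - '[x u, x u] =
    '[x (u - x u), u - x u] + ('[x u, x u] - '[x (x u), x u]).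
  by rewrite linear_funB // !innerE (xs (x u) u); ring.
by rewrite addr_ge0 ?x0 // subr_ge0 x1.
Qed.

Lemma effect_norm_le x v : effect x -> `|x v| <= `|v|.
Proof.
move=> xe; rewrite -(ler_pXn2r (n := 2)) ?nnegrE // !inner_norm.
by apply: le_trans (effect_sqr_le _ xe) _; case: xe.
Qed.

Lemma effect_bounded x : effect x -> bounded_ops x.
Proof.
move=> xe; split; first by case: xe.
by exists 1 => v; rewrite mul1r effect_norm_le.
Qed.

Lemma effect_adj x : effect x -> adj x = x.
Proof.
move=> xe; apply: adj_eq; split; first exact: effect_bounded.
by case: xe.
Qed.

Lemma effect_eq0 x u : effect x -> '[x u, u] <= 0 -> x u = 0.
Proof.
move=> xe x0; apply: inner_eq0; apply/eqP; rewrite eq_le inner_ge0 andbT.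
exact: le_trans (effect_sqr_le _ xe) x0.
Qed.

(** By [effect_sqr_le], [|u - x u|^2 = <u, u> - 2 <x u, u> + |x u|^2] is at most
    [<u, u> - <x u, u> <= 0]. *)
Lemma effect_fix x u : effect x -> '[u, u] <= '[x u, u] -> x u = u.
Proof.
move=> xe ux; have [xl xs x0 x1] := xe.
apply/esym/eqP; rewrite -subr_eq0; apply/eqP/inner_eq0/eqP.
rewrite eq_le inner_ge0 andbT !innerE -xs -subr_ge0.
have le1 := effect_sqr_le u xe; rewrite -subr_ge0 in le1.
rewrite -subr_ge0 in ux.
by have := addr_ge0 le1 ux; congr (0 <= _); ring.
Qed.

Lemma effectB x y : effect x -> effect y -> lef x y -> effect (y - x).
Proof.
move=> [xl xs x0 x1] [yl ys y0 y1] xy.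
have yxE v : (y - x) v = y v - x v by [].
split.
- move=> a u v; rewrite !yxE xl yl scalerBr opprD !addrA; congr (_ + _).
  by rewrite addrAC.
- by move=> u v; rewrite !yxE !innerE xs ys.
- by move=> v; rewrite yxE !innerE subr_ge0.
by move=> v; rewrite yxE !innerE; apply: le_trans (y1 v); rewrite gerBl.
Qed.

Lemma effect0 : effect 0.
Proof.
have zE v : (0 : H -> H) v = 0 by [].
split=> [a u v|u v|v|v]; rewrite ?zE ?inner0l ?inner0r ?inner_ge0 //.
by rewrite scaler0 addr0.
Qed.

(* The odd polynomial (3 t - t^3) / 2 maps [0, 1] to itself, dominates t there,
   and its fixed points in [0, 1] are 0 and 1. *)
Definition newton_schulz x : H -> H :=
  (3 / 2) *: x + (- 2^-1) *: (x \o (x \o x)).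

Lemma newton_schulz_inner x v : effect x ->
  '[newton_schulz x v, v] = 3 / 2 * '[x v, v] - 2^-1 * '[x (x v), x v].
Proof.
move=> [xl xs _ _].
have -> : newton_schulz x v = (3 / 2) *: x v + (- 2^-1) *: x (x (x v)) by [].
by rewrite !innerE (xs (x (x v))) mulNr.
Qed.

(** The difference is half of [(x - x^2) + (x^2 - x^3)], and both brackets are positive. *)
Lemma newton_schulz_ge x : effect x -> lef x (newton_schulz x).
Proof.
move=> xe v; rewrite newton_schulz_inner // -subr_ge0.
have le1 := effect_sqr_le v xe; have [_ _ _ /(_ (x v)) le2] := xe.
rewrite -subr_ge0 in le1; rewrite -subr_ge0 in le2.
have := addr_ge0 le1 le2.
rewrite -(pmulr_rge0 _ (x := 2^-1)) ?invr_gt0 //.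
by congr (0 <= _); field.
Qed.

Lemma effect_newton_schulz x : effect x -> effect (newton_schulz x).
Proof.
move=> xe; have [xl xs x0 x1] := xe; split.
- have [] // : bounded_ops (newton_schulz x).
  have xb := effect_bounded xe.
  apply: bounded_scaleD => //; rewrite -[_ *: _]addr0.
  apply: bounded_scaleD; first by do 2!apply: bounded_comp => //.
  exact: effect_bounded effect0.
- move=> u v; have nE w :
    newton_schulz x w = (3 / 2) *: x w + (- 2^-1) *: x (x (x w)) by [].
  rewrite !nE !innerE !xs; congr (_ * _ + _ * _).
    by apply/esym/CrealP; rewrite realM ?realV ?realn.
  by apply/esym/CrealP; rewrite realN realV realn.
- by move=> v; apply: le_trans (x0 v) (newton_schulz_ge xe v).
move=> v; rewrite newton_schulz_inner // -subr_ge0.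
(* Here [1 - (3 x - x^3) / 2 = (1 - x)^2 + (1 - x) x (1 - x) / 2]. *)
have le1 := inner_ge0 (v - x v); have le2 := x0 (v - x v).
have := addr_ge0 le1 (mulr_ge0 (_ : 0 <= 2^-1) le2); rewrite invr_ge0 ler0n => /(_ isT).
rewrite linear_funB // !innerE (xs (x v) v) -(xs v v).
by congr (0 <= _); field.
Qed.

(** The hypothesis says [x <= x^3]; with [x^2 <= x] this gives [x^2 <= x^3], so [effect_fix] applies
    at the vector [x v]. *)
Lemma newton_schulz_fixed x : effect x -> lef (newton_schulz x) x ->
  forall v, x (x v) = x v.
Proof.
move=> xe le1 v; apply: effect_fix => //; have := le1 v.
rewrite newton_schulz_inner // -subr_ge0 => le2.
have le3 := effect_sqr_le v xe; rewrite -subr_ge0 in le3.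
rewrite -subr_ge0; have := addr_ge0 le3 (mulr_ge0 (ler0n _ 2) le2).
by congr (0 <= _); field.
Qed.

(** * Limits of chains of effects, and maximal effects by Zorn's lemma *)

Section EffectChain.
Context (E : set (H -> H)).
Context (E_closed : forall x, bounded_ops x -> weak_star_closure E x -> E x).

(* The bound is the strong limit of the chain (Vigier): by [effect_sqr_le], for
   x <= y in the chain, |(y - x) v|^2 <= <y v, v> - <x v, v>. *)
Lemma effect_chain_ub (D : set (H -> H)) : D !=set0 ->
  (forall x, D x -> E x /\ effect x) -> total_on D lef ->
  exists e, [/\ E e, effect e & forall x, D x -> lef x e].
Proof.
move=> D0 DE Dtot.
pose up x := [set y | D y /\ lef x y].
have lefxx x : lef x x by [].
have upD x : D x -> up x x by [].
have up2 x y : D x -> D y -> exists2 z, D z & up z `<=` up x `&` up y.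
  move=> Dx Dy; case: (Dtot x y Dx Dy) => xy; [exists y|exists x] => // z [Dz zP];
    by split; split=> // v; apply: le_trans (zP v).
have /choice [e eP] : forall v, exists l, forall d : C, 0 < d ->
    exists2 x, D x & forall u, ((@^~ v) @` up x) u -> `|u - l| < d.
  move=> v.
  apply: (@cauchy_base_cvg R H _ D (fun x => (@^~ v) @` up x))
    => [//|x Dx|x y Dx Dy|d d0].
  - by exists (x v), x => //; apply: upD.
  - have [z Dz zP] := up2 x y Dx Dy; exists z => // _ [w /zP[wx wy] <-].
    by split; exists w.
  have d2 : 0 < d ^+ 2 / 2 by rewrite divr_gt0 ?exprn_gt0.
  (* Beyond an [x] with [<x v, v>] within [d^2 / 2] of the supremum over the chain, this number
     grows by at most [d^2 / 2], which bounds [|z v - y v|^2]. *)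
  have [|||] := @almost_max R [set '[x v, v] | x in D] '[v, v] _ _ _ _ d2.
  - by case: D0 => x Dx; exists ('[x v, v]), x.
  - by rewrite ger0_real ?inner_ge0.
  - by move=> _ [x /DE[_ [_ _ _ x1]] <-].
  move=> _ [x Dx <-] xmax; exists x => //.
  have close y z : up x y -> up x z -> lef y z -> `|z v - y v| < d.
    move=> [Dy xy] [Dz xz] yz.
    have zye : effect (z - y) by apply: effectB => //; apply DE.
    rewrite -(ltr_pXn2r (n := 2)) ?nnegrE ?(ltW d0) // inner_norm.
    apply: le_lt_trans (effect_sqr_le v zye) _.
    change ('[z v - y v, v] < d ^+ 2); rewrite !innerE.
    apply: le_lt_trans (_ : d ^+ 2 / 2 < _); last first.
      by rewrite ltr_pdivrMr // ltr_pMr ?exprn_gt0 // ltr1n.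
    rewrite lerBlDr addrC; apply: le_trans (xmax _ _) _; first by exists z.
    by rewrite lerD2r.
  move=> _ _ [y yx <-] [z zx <-]; case: (Dtot y z yx.1 zx.1) => yz.
    by rewrite distrC; apply: close.
  exact: close.
pose G := filter_from D up.
have GF : ProperFilter G.
  apply: filter_from_proper => [|x Dx]; last by exists x; apply: upD.
  exact: filter_from_filter.
have Gnear v d : 0 < d -> G (fun y => `|y v - e v| < d).
  move=> d0; have [x Dx xP] := eP v d d0; exists x => // y xy.
  by apply: xP; exists y.
have Gup x : D x -> G (up x) by exists x.
have Geff : G (fun y => E y /\ effect y).
  by case: D0 => x /Gup; apply: filterS => y [/DE].
have inner_near y v d : `|y v - e v| < d -> `|'[e v, v] - '[y v, v]| <= d * (1 + `|v|).
  move=> yv; rewrite -innerNl -innerDl.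
  apply: le_trans (inner_CauchySchwarz _ _) _.
  apply: ler_pM => //; first by rewrite distrC ltW.
  by rewrite lerDr.
have v1 v : 0 < 1 + `|v| by rewrite ltr_wpDr.
have e_ub x : D x -> lef x e.
  move=> Dx v; apply: (ge_approx (v1 v)) => d d0.
  have [y [[Dy xy] yv]] := filter_ex (filterI (Gup x Dx) (Gnear v d d0)).
  by exists '[y v, v]; [exact: xy|exact: inner_near].
(* Each condition passes to the limit by comparing [e] with one member [y] of the chain that is
   close to it at the finitely many vectors involved. *)
have ee : effect e.
  split.
  - move=> a u v; apply/eqP; rewrite -subr_eq0; apply/eqP.
    apply: (@norm_small_eq0 R H (1 + (`|a| + 1))).
      by rewrite ltr_wpDr // addr_ge0.
    move=> d d0.
    have [y [[[_ [yl _ _ _]] yauv] [yu yv]]] := filter_ex (filterI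
      (filterI Geff (Gnear (a *: u + v) d d0)) (filterI (Gnear u d d0) (Gnear v d d0))).
    have -> : e (a *: u + v) - (a *: e u + e v) =
        (e (a *: u + v) - y (a *: u + v)) + (a *: (y u - e u) + (y v - e v)).
      by rewrite (yl a) scalerBr [X in _ = _ + X]addrACA -opprD addrA subrK.
    rewrite !mulrDr mulr1; apply: le_trans (ler_normD _ _) _.
    apply: lerD; first by rewrite distrC ltW.
    apply: le_trans (ler_normD _ _) _; apply: lerD; last exact: ltW.
    by rewrite normrZ mulrC ler_wpM2r // ltW.
  - move=> u v; apply/eqP; rewrite -subr_eq0; apply/eqP.
    apply: (@norm_small_eq0 R C^o ((1 + `|v|) + (1 + `|u|))); first by rewrite addr_gt0.
    move=> d d0.
    have [y [[_ [_ ys _ _]] [yu yv]]] := filter_ex (filterI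
      Geff (filterI (Gnear u d d0) (Gnear v d d0))).
    have -> : '[e u, v] - '[u, e v] = '[e u - y u, v] + '[u, y v - e v].
      by rewrite !innerE ys; ring.
    rewrite mulrDr; apply: le_trans (ler_normD _ _) _; apply: lerD.
      apply: le_trans (inner_CauchySchwarz _ _) _.
      by rewrite ler_pM ?lerDr // distrC ltW.
    apply: le_trans (inner_CauchySchwarz _ _) _.
    by rewrite mulrC ler_pM ?lerDr // ltW.
  - case: D0 => x Dx v; have [_ [_ _ x0 _]] := DE x Dx.
    exact: le_trans (x0 v) (e_ub x Dx v).
  (* Since [ge_approx] transports lower bounds, the upper bound is negated first. *)
  move=> v; rewrite -lerN2; apply: (ge_approx (v1 v)) => d d0.
  have [y [[_ [_ _ _ y1]] yv]] := filter_ex (filterI Geff (Gnear v d d0)).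
  exists (- '[y v, v]); first by rewrite lerN2.
  by rewrite -opprD normrN inner_near.
exists e; split => //; apply: E_closed; first exact: effect_bounded.
apply: (@strong_limit_weak_star_closure E e G) => //.
  by apply: filterS Geff => y [Ey ye]; split=> // v; apply: effect_norm_le.
by move=> v; apply: effect_norm_le.
Qed.

Lemma maximal_effect z : E z -> effect z ->
  exists r, [/\ E r, effect r, lef z r &
    forall s, E s -> effect s -> lef r s -> lef s r].
Proof.
move=> Ez ze; pose T := {x | [/\ E x, effect x & lef z x]}.
have zz : [/\ E z, effect z & lef z z] by split=> // v.
pose z0 : T := exist _ z zz.
have [||A Atot|[r [Er re zr]] rmax] :=
    ZL_preorder z0 (R := fun s t : T => `[< lef (sval s) (sval t) >]).
- by move=> t; apply/asboolP.
- move=> r s t /asboolP sr /asboolP rt; apply/asboolP => v.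
  exact: le_trans (sr v) (rt v).
(* The strong limit exists for nonempty chains; the empty chain is bounded by [z] itself. *)
- have [A0|/set0P[a Aa]] := eqVneq A set0.
    by exists z0 => s; rewrite A0.
  have [||x y [s As <-] [t At <-]|e [Ee ee eub]] := @effect_chain_ub (sval @` A).
  + by exists (sval a), a.
  + by move=> _ [[x [Ex xe zx]] _ <-].
  + by case: (Atot s t As At) => /asboolP st; [left|right].
  have ze' : lef z e.
    move=> v; case: (svalP a) => _ _ za; apply: le_trans (za v) _.
    by apply: eub; exists a.
  have eP : [/\ E e, effect e & lef z e] by [].
  exists (exist _ e eP) => s As; apply/asboolP => /=; apply: eub; by exists s.
exists r; split=> // s Es se rs.
have zs : lef z s by move=> v; apply: le_trans (zr v) (rs v).
have sP : [/\ E s, effect s & lef z s] by [].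
have /= := rmax (exist _ s sP); move/(_ (introT (asboolP _) rs)).
by move/asboolP.
Qed.

End EffectChain.

(** * Positive operators and their scaling to effects *)

Lemma positive_symmetric x : linear x -> (forall v, 0 <= '[x v, v]) ->
  forall u v, '[x u, v] = '[u, x v].
Proof.
move=> xl x0.
have xvv v : '[x v, v] = '[v, x v].
  by rewrite [RHS]innerC; apply/esym/CrealP/ger0_real.
(* Polarisation with [u + v] and [u + i v]. *)
move=> u v; have := xvv (u + v); have := xvv (u + 'i *: v).
rewrite !linear_funD // linear_funZ // !innerE !xvv conjCi !(mulNr, mulrN).
move=> /eqP; rewrite -subr_eq0 => /eqP eq1 /eqP; rewrite -subr_eq0 => /eqP eq2.
have eq3 : 'i * (('[x v, u] - '[v, x u]) - ('[x u, v] - '[u, x v])) = 0.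
  by rewrite -[RHS]eq1; ring.
have {}eq1 := mulfI (neq0Ci C) (etrans eq3 (esym (mulr0 'i))).
have eq4 : 2 * ('[x u, v] - '[u, x v]) = 0.
  by rewrite -[RHS](subrr 0) -{1}eq2 -eq1; ring.
apply/eqP; rewrite -subr_eq0; move/eqP: eq4.
by rewrite mulf_eq0 pnatr_eq0.
Qed.

Lemma effect_half x y : effect x -> effect y -> effect (2^-1 *: x + 2^-1 *: y).
Proof.
move=> xe ye; have [_ xs x0 x1] := xe; have [_ ys y0 y1] := ye.
have zE v : (2^-1 *: x + 2^-1 *: y) v = 2^-1 *: x v + 2^-1 *: y v by [].
have h0 : 0 <= 2^-1 :> C by rewrite invr_ge0.
have hr : Num.conj 2^-1 = 2^-1 :> C by apply/CrealP/ger0_real.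
split.
- have [] // : bounded_ops (2^-1 *: x + 2^-1 *: y).
  apply: bounded_scaleD; first exact: effect_bounded.
  rewrite -[_ *: _]addr0; apply: bounded_scaleD; apply: effect_bounded => //.
  exact: effect0.
- by move=> u v; rewrite !zE !innerE !hr xs ys.
- by move=> v; rewrite zE !innerE addr_ge0 ?mulr_ge0.
move=> v; rewrite zE !innerE -mulrDr mulrC ler_pdivrMr //.
by rewrite mulr_natr mulr2n lerD.
Qed.

(** The scalar is the inverse of an operator bound [K], as [<x v, v> <= K |v|^2]. Statements about
    effects thereby extend to all positive elements. *)
Lemma positive_scale_effect x : bounded_ops x -> (forall v, 0 <= '[x v, v]) ->
  exists2 c : C, 0 < c & effect (c *: x).
Proof.
move=> xb x0; have [K K0 xK] := bounded_ops_nneg xb; have [xl _] := xb.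
have K1 : 0 < K^-1 by rewrite invr_gt0.
exists K^-1 => //.
have yE v : (K^-1 *: x) v = K^-1 *: x v by [].
split.
- by move=> a u v; rewrite !yE xl scalerDr !scalerA mulrC.
- move=> u v; rewrite !yE !innerE (positive_symmetric xl x0); congr (_ * _).
  by apply/esym/CrealP/gtr0_real.
- by move=> v; rewrite yE innerZl mulr_ge0 // ltW.
move=> v; rewrite yE innerZl mulrC ler_pdivrMr // -inner_norm.
apply: le_trans (real_ler_norm _) _; first exact: ger0_real.
apply: le_trans (inner_CauchySchwarz _ _) _.
by rewrite expr2 mulrC -mulrA ler_wpM2l // mulrC.
Qed.

(** * The largest projection of a weak* closed selfadjoint ternary ring *)

Section SelfadjointTRO.
Context (E : set (H -> H)).
Context (E_bounded : E `<=` bounded_ops).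
Context (E_closed : forall x, bounded_ops x -> weak_star_closure E x -> E x).
Context (E_subspace : is_subspace E).
Context (E_adj : forall x, E x -> E (adj x)).
Context (E_ternary : forall x y z, E x -> E y -> E z -> E (x \o adj y \o z)).

Lemma tro_scale (a : C) x : E x -> E (a *: x).
Proof.
by move=> Ex; rewrite -[_ *: _]addr0; apply: E_subspace.2 => //; apply: E_subspace.1.
Qed.

Lemma maximal_effect_idem r : E r -> effect r ->
  (forall s, E s -> effect s -> lef r s -> lef s r) ->
  forall v, r (r v) = r v.
Proof.
move=> Er re rmax; apply: newton_schulz_fixed => //; apply: rmax.
- apply: E_subspace.2 => //; apply: tro_scale.
  by have := E_ternary Er Er Er; rewrite (effect_adj re).
- exact: effect_newton_schulz.
- exact: newton_schulz_ge.
Qed.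

(** That [e] dominates an effect [x] is expressed as [x e = x], the form in which support on [e] is
    used afterwards. *)
Lemma largest_projection : exists e, [/\ E e, effect e,
  forall v, e (e v) = e v &
  forall x, E x -> effect x -> forall v, x (e v) = x v].
Proof.
have [e [Ee ee _ emax]] := maximal_effect E_closed E_subspace.1 effect0.
have ev := maximal_effect_idem Ee ee emax.
exists e; split=> // x Ex xe v.
have Ez : E (2^-1 *: e + 2^-1 *: x).
  by apply: E_subspace.2 => //; apply: tro_scale.
have [r [Er re zr rmax]] := maximal_effect E_closed Ez (effect_half ee xe).
have rv := maximal_effect_idem Er re rmax.
have [el es e0 _] := ee; have [xl _ x0 _] := xe; have [rl rs _ _] := re.
(* Since [r >= (e + x) / 2], a vector killed by [r] is killed by the positive operators [e] and [x];
   at [w - r w] this gives [e r = e] and [x r = x]. *)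
have ker w : r w = 0 -> e w = 0 /\ x w = 0.
  move=> rw; have := zr w; rewrite rw inner0l.
  change ('[2^-1 *: e w + 2^-1 *: x w, w] <= 0 -> e w = 0 /\ x w = 0).
  rewrite !innerE -mulrDr pmulr_rle0 ?invr_gt0 // => ex0.
  split; apply: effect_eq0 => //; apply: le_trans ex0.
    by rewrite lerDl.
  by rewrite lerDr.
have ker_r w : e (r w) = e w /\ x (r w) = x w.
  have [] := ker (w - r w); first by rewrite linear_funB // rv subrr.
  by rewrite !linear_funB // => /eqP + /eqP; rewrite !subr_eq0 => /eqP <- /eqP <-.
(* [e <= r], so [r = e] by maximality of [e]. *)
have er : lef e r.
  move=> w.
  have -> : '[e w, w] = '[e (r w), e (r w)] by rewrite (ker_r w).1 -es ev.
  have -> : '[r w, w] = '[r w, r w] by rewrite -rs rv.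
  rewrite -!inner_norm.
  by rewrite ler_pXn2r ?nnegrE // effect_norm_le.
have re0 w : r w = e w.
  apply/eqP; rewrite -subr_eq0; apply/eqP.
  apply: (effect_eq0 (effectB ee re er)).
  change ('[r w - e w, w] <= 0).
  by rewrite !innerE subr_le0; apply: emax.
by rewrite -re0 (ker_r v).2.
Qed.

(** * Commutation of the projection with the ternary ring *)

Section Commutation.
Context (e : H -> H) (Ee : E e) (ee : effect e).
Context (e_max : forall x, E x -> effect x -> forall v, x (e v) = x v).

Lemma tro_positive_supported x : E x -> (forall v, 0 <= '[x v, v]) ->
  forall v, x (e v) = x v.
Proof.
move=> Ex x0 v; have [c c0 cxe] := positive_scale_effect (E_bounded Ex) x0.
have := e_max (tro_scale c Ex) cxe v.
change (c *: x (e v) = c *: x v -> x (e v) = x v).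
by apply: scalerI; rewrite gt_eqF.
Qed.

Lemma compress_right x v : E x -> e (x (e v)) = e (x v).
Proof.
move=> Ex; have xb := E_bounded Ex; have [xl _] := xb; have [el es e0 _] := ee.
have ET := E_ternary (E_adj Ex) Ee Ex; rewrite (effect_adj ee) in ET.
have innerT u w : '[(adj x \o e \o x) u, w] = '[e (x u), x w].
  by rewrite /= inner_adjl.
have T0 u : 0 <= '[(adj x \o e \o x) u, u] by rewrite innerT.
have Tv := tro_positive_supported ET T0 v.
(* As [x^* e x] kills [v - e v], the vector [w = x (v - e v)] satisfies [<e w, w> = 0]. *)
apply/esym/eqP; rewrite -subr_eq0 -linear_funB // -linear_funB //; apply/eqP.
apply: effect_eq0 => //; rewrite -innerT linear_funB ?Tv ?subrr ?inner0l //.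
exact: (E_bounded ET).1.
Qed.

(** Taking adjoints in [e x^* = e x^* e] gives [x e = e x e], which equals [e x] by
    [compress_right]. *)
Lemma commute_projection x v : E x -> e (x v) = x (e v).
Proof.
move=> Ex; have xb := E_bounded Ex; have [el es e0 _] := ee.
rewrite -compress_right //; apply: inner_ext => u.
by rewrite es -!(inner_adjr _ _ xb) !es (compress_right u (E_adj Ex)).
Qed.

End Commutation.
End SelfadjointTRO.

End HilbertSpace.

(** * Splitting along the projection *)

Theorem corollary4p2 (R : realType) (E : starWTRO R) :
  exists (M : WstarAlgebra R) (Z : starWTRO R),
    trivially_ordered (wtro_ternary_of Z) /\
    exists f : wtro_ternary_of E -> dsum (wstar_ternary M) (wtro_ternary_of Z),
      ternary_star_iso f /\ complete_order_iso f.
Proof.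
pose N := wtro_ambient E; pose H := wstar_space N; pose S := wtro_set E.
have SN : S `<=` wstar_set N by case: (wtro_closed E).
have S_bounded : S `<=` bounded_ops.
  by move=> x /SN; case: (wstar_closed N) => + _; apply.
have S_closed x : bounded_ops x -> weak_star_closure S x -> S x.
  move=> xb xS; case: (wtro_closed E) => _; apply; split => //.
  case: (wstar_closed N) => _; apply; split => //.
  exact: weak_star_closureS xS.
have S_sub : is_subspace S := wtro_subspace E.
have S_adj x : S x -> S (adj x) := @wtro_adj _ E x.
have S_tern x y z : S x -> S y -> S z -> S (x \o adj y \o z) :=
  @wtro_ternary _ E x y z.
have [e [Se ee eK emax]] := largest_projection S_closed S_sub S_tern.
have ex x v : S x -> e (x v) = x (e v).
  exact: (commute_projection S_bounded S_sub S_adj S_tern Se ee emax).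
(* The element [e x = e e^* x] is a ternary product. *)
have Sex x : S x -> S (e \o x).
  move=> Sx; have := S_tern _ _ _ Se Se Sx; rewrite (effect_adj ee).
  by congr S; apply/funext => v /=; rewrite eK.
have [el es _ _] := ee.
have S_lin x : S x -> linear x by move=> /S_bounded[].
have SB x y : S x -> S y -> S (x - y).
  by move=> Sx Sy; rewrite addrC -scaleN1r; apply: S_sub.2.
have eD (a : R[i]) (x y : H -> H) : e \o (a *: x + y) = a *: (e \o x) + (e \o y).
  apply/funext => v; change (e (a *: x v + y v) = a *: e (x v) + e (y v)).
  by rewrite el.
have e_adj x : S x -> e \o adj x = adj (e \o x).
  move=> Sx; rewrite (adj_comp (effect_bounded ee) (S_bounded _ Sx)) (effect_adj ee).
  by apply/funext => v /=; rewrite ex //; apply: S_adj.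
have e_compl x v : S x -> e (x (v - e v)) = 0.
  by move=> Sx; rewrite ex // linear_funB // eK subrr linear_fun0 //; exact: S_lin.
(* These are [e E] and [(1 - e) E], written as solution sets of linear equations so that weak*
   closedness reduces to vector functionals. *)
pose Mset := [set x | S x /\ e \o x = x].
pose Zset := [set x | S x /\ e \o x = 0].
have M_closed : weak_star_closed_in bounded_ops Mset.
  split=> [x [/S_bounded]//|x [xb xM]].
  have Sx : S x by apply: S_closed => //; apply: weak_star_closureS xM => y [].
  split=> //; apply/funext => v; apply: inner_ext => w /=.
  (* The equation [e x = x] reads [<x v, e w - w> = 0] for all [v] and [w]. *)
  apply/eqP; rewrite -subr_eq0 es -innerNr -innerDr; apply/eqP.
  apply: (weak_star_closure_inner0 xb.1 xM) => y [Sy ey]; split; first exact: S_lin.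
  by rewrite innerDr innerNr -es -[e (y v)]/((e \o y) v) ey subrr.
have M_sub : is_subspace Mset.
  split; first by split; [exact: S_sub.1|apply/funext => v; exact: linear_fun0].
  by move=> a x y [Sx xe] [Sy ye]; split; [exact: S_sub.2|rewrite eD xe ye].
have M_adj x : Mset x -> Mset (adj x).
  by move=> [Sx xe]; split; [exact: S_adj|rewrite e_adj // xe].
have M_mul x y : Mset x -> Mset y -> Mset (x \o y).
  move=> [Sx xe] [Sy ye]; split.
    (* Since [e y = y], the product [x y] is the ternary product [x e^* y]. *)
    have := S_tern _ _ _ Sx Se Sy; rewrite (effect_adj ee).
    by rewrite -[X in _ \o X]/y; congr S; rewrite -{2}ye.
  by rewrite -{2}xe.
have M_unit : exists2 u, Mset u & forall x, Mset x -> u \o x = x /\ x \o u = x.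
  exists e; first by split=> //; apply/funext.
  move=> x [Sx xe]; split=> //; rewrite -{2}xe.
  by apply/funext => v /=; rewrite ex.
have Z_closed : weak_star_closed_in (wstar_set N) Zset.
  split=> [x [/SN]//|x [xN xZ]].
  have xb : bounded_ops x by case: (wstar_closed N) => + _; apply.
  have Sx : S x by apply: S_closed => //; apply: weak_star_closureS xZ => y [].
  split=> //; apply/funext => v; apply: inner_ext => w /=; rewrite inner0l es.
  apply: (weak_star_closure_inner0 xb.1 xZ) => y [Sy ey]; split; first exact: S_lin.
  by rewrite -es -[e (y v)]/((e \o y) v) ey inner0l.
have Z_sub : is_subspace Zset.
  split; first by split; [exact: S_sub.1|apply/funext => v; exact: linear_fun0].
  move=> a x y [Sx xe] [Sy ye]; split; first exact: S_sub.2.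
  by rewrite eD xe ye scaler0 addr0.
have adj0 : adj 0 = 0 :> (H -> H) by rewrite effect_adj //; exact: effect0.
have Z_adj x : Zset x -> Zset (adj x).
  by move=> [Sx xe]; split; [exact: S_adj|rewrite e_adj // xe adj0].
have Z_tern x y z : Zset x -> Zset y -> Zset z -> Zset (x \o adj y \o z).
  move=> [Sx xe] [Sy _] [Sz _]; split; first exact: S_tern.
  by apply/funext => v; rewrite /= -[e _]/((e \o x) _) xe.
pose M := MkWstarAlgebra M_closed M_sub M_adj M_mul M_unit.
pose Z := @MkStarWTRO R N Zset Z_closed Z_sub Z_adj Z_tern.
exists M, Z; split.
  apply/seteqP; split=> [x /= [/(_ ord0 ord0)/=]|_ -> /=].
    rewrite mxE => -[Sx xe] [_ xpos].
    have x0 v : 0 <= inner H (x v) v.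
      by have := xpos (fun=> v); rewrite !big_ord1 mxE.
    (* Positivity gives [x = x e], commutation gives [x e = e x], and [e x = 0] in [Z]. *)
    apply/funext => v.
    rewrite -(tro_positive_supported S_bounded S_sub emax Sx x0) -ex //.
    by rewrite -[e _]/((e \o x) v) xe.
  split; [|split].
  - by move=> i j; rewrite mxE; exact: Z_sub.1.
  - by move=> i j; rewrite mxE; exact: (wstar_subspace N).1.
  move=> xi; rewrite !big_ord1 mxE.
  by rewrite -[(0 : H -> H) _]/(0 : H) inner0l.
pose f (x : wtro_ternary_of E) : dsum (wstar_ternary M) (wtro_ternary_of Z) :=
  (e \o x, x - (e \o x)).
have f1 x : S x -> Mset (e \o x).
  by move=> Sx; split; [exact: Sex|apply/funext => v /=; rewrite eK].
have f2 x : S x -> Zset (x - (e \o x)).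
  move=> Sx; split; first by apply: SB => //; exact: Sex.
  apply/funext => v; change (e (x v - e (x v)) = 0).
  by rewrite linear_funB // eK subrr.
have f_bij : set_bij (ot_set (wtro_ternary_of E))
    (ot_set (dsum (wstar_ternary M) (wtro_ternary_of Z))) f.
  split.
  - by move=> x Sx; split; [exact: f1|exact: f2].
  - move=> x y /set_mem Sx /set_mem Sy [exy xy].
    by move: xy; rewrite exy => /addIr.
  move=> [m z] /= [[Sm em] [Sz ez]]; exists (m + z).
    by rewrite -[m]scale1r; apply: S_sub.2.
  have emz : e \o (m + z) = m.
    by rewrite -[m in LHS]scale1r eD scale1r em ez addr0.
  by rewrite /f emz addrC addKr.
exists f; split; last split=> //.
  split=> //.
  - move=> a x y Sx Sy; rewrite /f eD; congr pair.
    by rewrite /= scalerBr opprD addrACA.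
  - move=> x Sx; rewrite /f /= e_adj //; congr pair.
    rewrite adjB //; [exact: S_bounded|by apply: S_bounded; exact: Sex].
  - move=> x y z Sx Sy Sz; rewrite /f /=; congr pair.
      rewrite -e_adj //; apply/funext => v /=; have Sq := S_adj y Sy.
      by rewrite -(ex (adj y)) // eK -(ex x) // eK.
    rewrite adjB; [|exact: S_bounded|by apply: S_bounded; exact: Sex].
    rewrite -e_adj //; apply/funext => v; set q := adj y.
    have Sq : S q by exact: S_adj.
    have xl := S_lin x Sx; have ql := S_lin q Sq.
    (* With [1 - e] applied at each factor, [e (x s)] and [e (q w)] vanish, because [e] commutes
       with [x] and [q]. *)
    pose w := z v - e (z v); pose s := q w - e (q w).
    change (x (q (z v)) - e (x (q (z v))) = x s - e (x s)).
    rewrite e_compl // subr0 /s e_compl // subr0 /w (linear_funB _ _ ql) -(ex q) //.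
    by rewrite (linear_funB _ _ xl) -(ex x).
move=> n x Sx; split.
  move=> [_ [_ xpos]]; split; split.
  - by move=> i j; rewrite !mxE; exact: (f1 _ (Sx i j)).
  (* As [e x = e x e], the form of [e x] at [xi] is that of [x] at [e xi]; the second summand is
     treated likewise with [1 - e]. *)
  - move=> xi; have := xpos (fun i => e (xi i)).
    congr (0 <= _); apply: eq_bigr => i _; apply: eq_bigr => j _.
    by rewrite !mxE /= -es -(ex _ _ (Sx i j)) eK.
  - by move=> i j; rewrite !mxE; exact: (f2 _ (Sx i j)).
  - split; first by move=> i j; rewrite !mxE; exact: (SN _ (f2 _ (Sx i j)).1).
    move=> xi; have := xpos (fun i => xi i - e (xi i)).
    congr (0 <= _); apply: eq_bigr => i _; apply: eq_bigr => j _.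
    rewrite !mxE; have Sij := Sx i j; have xl := S_lin _ Sij.
    change (inner H (x i j (xi j - e (xi j))) (xi i - e (xi i)) =
      inner H (x i j (xi j) - e (x i j (xi j))) (xi i)).
    rewrite innerDr innerNr -es e_compl // inner0l subr0.
    by rewrite (linear_funB _ _ xl) -(ex _ _ Sij).
move=> [[_ Mpos] [_ [_ Zpos]]]; split=> //; split.
  by move=> i j; exact: (SN _ (Sx i j)).
(* The form of [x] is the sum of the forms of [e x] and [x - e x]. *)
move=> xi; have := addr_ge0 (Mpos xi) (Zpos xi).
rewrite -big_split; congr (0 <= _); apply: eq_bigr => i _.
rewrite -big_split; apply: eq_bigr => j _; rewrite !mxE /=.
rewrite -innerDl; congr (inner H _ _).
change (e (x i j (xi j)) + (x i j (xi j) - e (x i j (xi j))) = x i j (xi j)).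
by rewrite addrC subrK.
Qed.
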